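(* Let $\leftthreetimes\in\{\cap,\subset\}$. For a finite set $X$, $G\in\mathcal{H}[X]$ and $\sim\in\mathcal{E}[X]$, put $\delta^{(\leftthreetimes)}_\sim(G)=G/\sim\otimes G\mid_\leftthreetimes\sim\in\mathbf{H}[X/\sim]\otimes\mathbf{H}[X]$ if $\sim\in\mathcal{E}_\leftthreetimes[G]$, and $\delta^{(\leftthreetimes)}_\sim(G)=0$ otherwise (extended linearly). Then $\delta^{(\leftthreetimes)}$ is a contraction-extraction coproduct on $\mathbf{H}$ compatible with $m$ and $\Delta^{(\leftthreetimes)}$, namely: (a) (coassociativity) for all $G\in\mathcal{H}[X]$ and $\sim\leqslant\sim'$ in $\mathcal{E}[X]$, $(\delta^{(\leftthreetimes)}_{\overline{\sim}}\otimes\mathrm{Id})\circ\delta^{(\leftthreetimes)}_{\sim'}(G)=(\mathrm{Id}\otimes\delta^{(\leftthreetimes)}_{\sim'})\circ\delta^{(\leftthreetimes)}_\sim(G)$ (identifying $(X/\sim')/\overline{\sim}$ with $X/\sim$); (b) (counit) with $\epsilon_\delta$ defined on $G\in\mathcal{H}[X]$ by $\epsilon_\delta(G)=1$ if $E^+(G)=\emptyset$ and $0$ otherwise, one has $\sum_{\sim\in\mathcal{E}[X]}(\epsilon_\delta\otimes\mathrm{Id})\circ\delta^{(\leftthreetimes)}_\sim(G)=G$ and $\sum_{\sim\in\mathcal{E}[X]}(\mathrm{Id}\otimes\epsilon_\delta)\circ\delta^{(\leftthreetimes)}_\sim(G)=G$; (c) (multiplicativity) for disjoint $X,Y$, $G\in\mathcal{H}[X]$,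 $G'\in\mathcal{H}[Y]$ and $\sim\in\mathcal{E}[X\sqcup Y]$: if $\sim=\sim_X\sqcup\sim_Y$ with $\sim_X\in\mathcal{E}[X]$, $\sim_Y\in\mathcal{E}[Y]$, then $\delta^{(\leftthreetimes)}_\sim(GG')=\delta^{(\leftthreetimes)}_{\sim_X}(G)\,\delta^{(\leftthreetimes)}_{\sim_Y}(G')$ (componentwise product), and otherwise $\delta^{(\leftthreetimes)}_\sim(GG')=0$; (d) (compatibility with $\Delta^{(\leftthreetimes)}$) for $G\in\mathcal{H}[X\sqcup Y]$, $\sim_X\in\mathcal{E}[X]$, $\sim_Y\in\mathcal{E}[Y]$ and $\sim=\sim_X\sqcup\sim_Y$, $(\Delta^{(\leftthreetimes)}_{X/\sim_X,Y/\sim_Y}\otimes\mathrm{Id})\circ\delta^{(\leftthreetimes)}_\sim(G)=m_{1,3,24}\circ(\delta^{(\leftthreetimes)}_{\sim_X}\otimes\delta^{(\leftthreetimes)}_{\sim_Y})\circ\Delta^{(\leftthreetimes)}_{X,Y}(G)$, where $m_{1,3,24}(a_1\otimes a_2\otimes a_3\otimes a_4)=a_1\otimes a_3\otimes a_2a_4$.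
   Context: Hypergraph: pair $G=(V(G),E(G))$, $V(G)$ finite, $E(G)\subseteq\mathcal{P}(V(G))$ containing $\emptyset$ and all singletons $\{x\}$, $x\in V(G)$; $E^+(G)=\{e\in E(G)\mid |e|\geq 2\}$. $\mathcal{H}[X]$: hypergraphs with vertex set $X$; $\mathbf{H}[X]$: vector space over a field of characteristic zero with basis $\mathcal{H}[X]$. For $I\subseteq V(G)$: $G_{\mid_\subset I}$ has vertex set $I$ and edges $\{e\in E(G)\mid e\subseteq I\}$; $G_{\mid_\cap I}$ has vertex set $I$ and edges $\{e\cap I\mid e\in E(G)\}$. Product: $GG'$ has vertex set $V(G)\sqcup V(G')$ and edges $E(G)\cup E(G')$. $\Delta^{(\leftthreetimes)}_{X,Y}(G)=G_{\mid_\leftthreetimes X}\otimes G_{\mid_\leftthreetimes Y}$ for $G\in\mathcal{H}[X\sqcup Y]$. Paths/connectedness: a path is a sequence of vertices with consecutive ones in a common edge; $G$ is connected if any two vertices are joined by a path. $\mathcal{E}[X]$: equivalence relations on $X$, with $\sim\leqslant\sim'$ iff ($x\sim'y\Rightarrow x\sim y$); for $\sim\leqslant\sim'$, $\overline{\sim}$ is the equivalence on $X/\sim'$ with $\overline{x}\,\overline{\sim}\,\overline{y}\iff x\sim y$. For $\sim\in\mathcal{E}[X]$ with canonical surjection $\pi_\sim$: $G/\sim$ has vertex set $X/\sim$ and edges $\{\pi_\sim(e)\mid e\in E(G)\}$; $G\mid_\leftthreetimes\sim=\prod_{C\in X/\sim}G_{\mid_\leftthreetimes C}$; $\sim\in\mathcal{E}_\leftthreetimes[G]$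 iff $G_{\mid_\leftthreetimes C}$ is connected for every class $C$. *)

(* Defs.v *)
From HB Require Import structures.
From mathcomp Require Import all_boot all_order all_algebra.
From mathcomp.multinomials Require Import freeg.

Set Implicit Arguments.
Unset Strict Implicit.
Unset Printing Implicit Defensive.

Import GRing.Theory.
Local Open Scope ring_scope.
Local Open Scope quotient_scope.

Section Equivalences.
Variable X : finType.

Definition eqv_axiom (f : {ffun X * X -> bool}) : bool :=
  [&& [forall x, f (x, x)],
      [forall x, forall y, f (x, y) ==> f (y, x)]
    & [forall x, forall y, forall z, f (x, y) ==> f (y, z) ==> f (x, z)]].

Record eqv := Eqv { eqv_val : {ffun X * X -> bool}; _ : eqv_axiom eqv_val }.

HB.instance Definition _ := [isSub for eqv_val].
HB.instance Definition _ := [Finite of eqv by <:].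

Definition eqv_fun (r : eqv) : rel X := fun x y => eqv_val r (x, y).
Coercion eqv_fun : eqv >-> rel.

Lemma eqv_refl (r : eqv) : reflexive r.
Proof. by case: r => f fP x; have /and3P[/forallP fr _ _] := fP; apply: fr. Qed.

Lemma eqv_sym (r : eqv) : symmetric r.
Proof.
case: r => f fP; have /and3P[_ /forallP fs _] := fP.
have H x y : f (x, y) -> f (y, x) by have /forallP/(_ y)/implyP := fs x.
by move=> x y; apply/idP/idP; apply: H.
Qed.

Lemma eqv_trans (r : eqv) : transitive r.
Proof.
case: r => f fP y x z; have /and3P[_ _ /forallP ft] := fP.
have /forallP/(_ y)/forallP/(_ z)/implyP H := ft x.
by move=> /H/implyP; apply.
Qed.

Lemma mk_eqv_subproof (e : rel X) :
    reflexive e -> symmetric e -> transitive e ->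
  eqv_axiom [ffun p => e p.1 p.2].
Proof.
move=> er es et; apply/and3P; split.
- by apply/forallP => x; rewrite ffunE /=.
- apply/forallP => x; apply/forallP => y.
  by rewrite !ffunE /= es; apply/implyP.
apply/forallP => x; apply/forallP => y; apply/forallP => z.
by rewrite !ffunE /=; apply/implyP => xy; apply/implyP; apply: et.
Qed.

Definition mk_eqv (e : rel X) (er : reflexive e) (es : symmetric e)
    (et : transitive e) : eqv :=
  Eqv (mk_eqv_subproof er es et).

Lemma mk_eqvE (e : rel X) er es et x y : @mk_eqv e er es et x y = e x y.
Proof. by rewrite /eqv_fun /= ffunE. Qed.

Definition eqv_equiv (r : eqv) : equiv_rel X :=
  EquivRel r (@eqv_refl r) (@eqv_sym r) (@eqv_trans r).

Definition quo (r : eqv) : Type := {eq_quot (eqv_equiv r)}.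
HB.instance Definition _ (r : eqv) := EqQuotient.on (quo r).
HB.instance Definition _ (r : eqv) := Countable.on (quo r).
HB.instance Definition _ (r : eqv) : isFinite (quo r) :=
  CanIsFinite (@reprK _ (quo r)).

Definition cls (r : eqv) (x : X) : quo r := \pi_(quo r) x.

Definition class_set (r : eqv) (c : quo r) : {set X} := [set x | cls r x == c].

Lemma cls_eq (r : eqv) x y : (cls r x == cls r y) = r x y.
Proof. exact: (@eqquotE _ (eqv_equiv r) (quo r)). Qed.

Lemma cls_repr (r : eqv) (c : quo r) : cls r (repr c) = c.
Proof. exact: reprK. Qed.

Lemma repr_cls (r : eqv) x : r (repr (cls r x)) x.
Proof. by rewrite -cls_eq cls_repr. Qed.

Lemma cls_surj (r : eqv) (c : quo r) : exists x, cls r x = c.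
Proof. by exists (repr c); apply: cls_repr. Qed.

(* r <= r' when r' is finer than r *)
Definition eqv_le (r r' : eqv) : Prop := forall x y, r' x y -> r x y.

Definition eqv_eq : eqv :=
  mk_eqv (@eqxx X) (@eq_sym X) (fun y x z (xy : x == y) =>
    etrans (congr1 (fun t => t == z) (eqP xy))).

Lemma cls_eq_inj : injective (@cls eqv_eq).
Proof. by move=> x y /eqP; rewrite cls_eq mk_eqvE => /eqP. Qed.

Lemma cls_eq_bij : bijective (@cls eqv_eq).
Proof.
by exists (fun c => repr c) => [x|c]; rewrite ?cls_repr //;
  apply: cls_eq_inj; rewrite cls_repr.
Qed.

End Equivalences.

Arguments eqv_eq : clear implicits.

(* The relation that r induces on the classes of r'. Comparing                *)
(* representatives makes this total in r and r'; see eqv_barE for r <= r'.    *)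
Section Bar.
Variables (X : finType) (r r' : eqv X).

Definition bar_rel : rel (quo r') := fun c d => r (repr c) (repr d).

Definition eqv_bar : eqv (quo r') :=
  @mk_eqv _ bar_rel (fun c => eqv_refl r (repr c))
    (fun c d => eqv_sym r (repr c) (repr d))
    (fun d c e => @eqv_trans _ r (repr d) (repr c) (repr e)).

Hypothesis le_rr' : eqv_le r r'.

Lemma eqv_barE x y : eqv_bar (cls r' x) (cls r' y) = r x y.
Proof.
rewrite mk_eqvE /bar_rel -!cls_eq.
have H z : cls r (repr (cls r' z)) = cls r z.
  by apply/eqP; rewrite cls_eq; apply/le_rr'/repr_cls.
by rewrite !H.
Qed.

(* (X / r') / bar = X / r, sending the class of the class of x to that of x *)
Definition bar_iso (c : quo eqv_bar) : quo r := cls r (repr (repr c)).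

Lemma bar_isoE x : bar_iso (cls eqv_bar (cls r' x)) = cls r x.
Proof.
apply/eqP; rewrite cls_eq -eqv_barE cls_repr.
exact: repr_cls.
Qed.

Lemma bar_iso_bij : bijective bar_iso.
Proof.
exists (fun c => cls eqv_bar (cls r' (repr c))) => c.
  rewrite -{2}[c]cls_repr -[repr c in RHS]cls_repr; apply/eqP.
  by rewrite cls_eq eqv_barE repr_cls.
by rewrite bar_isoE cls_repr.
Qed.

End Bar.

Section Sum.
Variables (X Y : finType) (rX : eqv X) (rY : eqv Y).

Definition sum_rel : rel (X + Y)%type := fun u v =>
  match u, v with
  | inl x, inl x' => rX x x'
  | inr y, inr y' => rY y y'
  | _, _ => false
  end.

Fact sum_rel_refl : reflexive sum_rel.
Proof. by case=> x; apply: eqv_refl. Qed.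

Fact sum_rel_sym : symmetric sum_rel.
Proof. by case=> x [] y //; apply: eqv_sym. Qed.

Fact sum_rel_trans : transitive sum_rel.
Proof. by case=> x [] y [] z //; apply: eqv_trans. Qed.

Definition eqv_sum : eqv (X + Y)%type :=
  mk_eqv sum_rel_refl sum_rel_sym sum_rel_trans.

(* (X + Y) / (rX + rY) = X / rX + Y / rY *)
Definition sum_iso (c : quo eqv_sum) : (quo rX + quo rY)%type :=
  match repr c with
  | inl x => inl (cls rX x)
  | inr y => inr (cls rY y)
  end.

Lemma sum_isoE u :
  sum_iso (cls eqv_sum u) =
  match u with inl x => inl (cls rX x) | inr y => inr (cls rY y) end.
Proof.
rewrite /sum_iso; have := repr_cls eqv_sum u; rewrite mk_eqvE.
by case: (repr (cls _ _)) => z; case: u => z' //=; rewrite -cls_eq => /eqP ->.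
Qed.

Lemma sum_iso_bij : bijective sum_iso.
Proof.
pose g (c : (quo rX + quo rY)%type) : quo eqv_sum :=
  match c with
  | inl d => cls eqv_sum (inl (repr d))
  | inr d => cls eqv_sum (inr (repr d))
  end.
exists g; last by case=> d; rewrite sum_isoE cls_repr.
move=> c; rewrite -[c]cls_repr sum_isoE; case: (repr c) => x;
  by apply/eqP; rewrite cls_eq mk_eqvE /= repr_cls.
Qed.

End Sum.

Section Hypergraph.
Variable X : finType.

Definition hyp_axiom (E : {set {set X}}) : bool :=
  (set0 \in E) && [forall x, [set x] \in E].

(* The hypergraphs whose vertex set is X *)
Record hypergraph := Hypergraph {
  edges : {set {set X}};
  _ : hyp_axiom edges
}.

HB.instance Definition _ := [isSub for edges].
HB.instance Definition _ := [Finite of hypergraph by <:].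

Lemma edges0 (G : hypergraph) : set0 \in edges G.
Proof. by case: G => E /= /andP[]. Qed.

Lemma edges1 (G : hypergraph) x : [set x] \in edges G.
Proof. by case: G => E /= /andP[_ /forallP]. Qed.

Definition edges_plus (G : hypergraph) : {set {set X}} :=
  [set e in edges G | (1 < #|e|)%N].

Definition adj (G : hypergraph) : rel X :=
  fun x y => [exists e in edges G, (x \in e) && (y \in e)].

(* connect (adj G) x y: there is a path from x to y, cf. connectP *)
Definition hconnected (G : hypergraph) : bool :=
  [forall x, forall y, connect (adj G) x y].

End Hypergraph.

Section Image.
Variables (X Y : finType) (f : X -> Y).
Hypothesis f_surj : forall y, exists x, f x = y.

Lemma himage_subproof (G : hypergraph X) :
  hyp_axiom [set f @: e | e : {set X} in edges G].
Proof.
apply/andP; split; first by apply/imsetP; exists set0; rewrite ?edges0 ?imset0.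
apply/forallP => y; have [x <-] := f_surj y.
by apply/imsetP; exists [set x]; rewrite ?edges1 ?imset_set1.
Qed.

Definition himage (G : hypergraph X) : hypergraph Y :=
  Hypergraph (himage_subproof G).

End Image.

Lemma bij_surj (X Y : Type) (f : X -> Y) :
  bijective f -> forall y, exists x, f x = y.
Proof. by case=> g _ gK y; exists (g y). Qed.

Definition hrelabel (X Y : finType) (f : X -> Y) (f_bij : bijective f) :
  hypergraph X -> hypergraph Y := himage (bij_surj f_bij).

(* G / r *)
Definition hcontract (X : finType) (r : eqv X) :
  hypergraph X -> hypergraph (quo r) := himage (@cls_surj X r).

(* RCap: edges e :&: I; RSub: edges e \subset I. The part I of the vertex set *)
(* is given by an injection f : I -> X, along which subsets of I are         *)
(* identified with subsets of X: then f @^-1: e is the intersection of e     *)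
(* and I.                                                                    *)
Variant restriction_kind := RCap | RSub.

Section Restriction.
Variables (k : restriction_kind) (I X : finType) (f : I -> X).
Hypothesis f_inj : injective f.

Definition restr_edges (E : {set {set X}}) : {set {set I}} :=
  match k with
  | RCap => [set f @^-1: e | e : {set X} in E]
  | RSub => [set e : {set I} | f @: e \in E]
  end.

Lemma hrestr_subproof (G : hypergraph X) : hyp_axiom (restr_edges (edges G)).
Proof.
rewrite /restr_edges; apply/andP; case: k; split.
- by apply/imsetP; exists set0; rewrite ?edges0 ?preimset0.
- apply/forallP => i; apply/imsetP; exists [set f i]; rewrite ?edges1 //.
  by apply/setP => j; rewrite !inE inj_eq.
- by rewrite inE imset0 edges0.
- by apply/forallP => i; rewrite inE imset_set1 edges1.
Qed.

Definition hrestr (G : hypergraph X) : hypergraph I :=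
  Hypergraph (hrestr_subproof G).

End Restriction.

Arguments hrestr k {I X f} f_inj G.

Lemma inl_injective (X Y : Type) : injective (@inl X Y).
Proof. by move=> x x' []. Qed.

Lemma inr_injective (X Y : Type) : injective (@inr X Y).
Proof. by move=> y y' []. Qed.

Section Product.
Variables (X Y : finType) (G : hypergraph X) (G' : hypergraph Y).

Lemma hprod_subproof :
  hyp_axiom ([set (@inl X Y) @: e | e : {set X} in edges G]
         :|: [set (@inr X Y) @: e | e : {set Y} in edges G']).
Proof.
apply/andP; split.
  by rewrite inE; apply/orP; left; apply/imsetP; exists set0;
    rewrite ?edges0 ?imset0.
apply/forallP => -[x|y]; rewrite inE; apply/orP; [left|right]; apply/imsetP.
  by exists [set x]; rewrite ?edges1 ?imset_set1.
by exists [set y]; rewrite ?edges1 ?imset_set1.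
Qed.

Definition hprod : hypergraph (X + Y)%type := Hypergraph hprod_subproof.

End Product.

Section ClassProduct.
Variables (k : restriction_kind) (X : finType) (r : eqv X) (G : hypergraph X).

Definition hclass (c : quo r) : hypergraph {x | x \in class_set c} :=
  hrestr k val_inj G.

(* The product of the G|C over the classes C, whose vertex set (the disjoint *)
(* union of the classes) is X. The explicit set0 matters only for X empty,   *)
(* when the product is empty.                                                *)
Definition hextract_edges : {set {set X}} :=
  set0 |: \bigcup_(c : quo r)
    [set val @: e | e : {set {x | x \in class_set c}} in edges (hclass c)].

Lemma hextract_subproof : hyp_axiom hextract_edges.
Proof.
apply/andP; split; first by rewrite !inE eqxx.
apply/forallP => x; rewrite inE; apply/orP; right.
have xP : x \in class_set (cls r x) by rewrite inE.
apply/bigcupP; exists (cls r x) => //; apply/imsetP.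
by exists [set Sub x xP]; rewrite ?edges1 ?imset_set1 ?SubK.
Qed.

Definition hextract : hypergraph X := Hypergraph hextract_subproof.

(* r belongs to E_k[G] *)
Definition eqv_connected : bool := [forall c : quo r, hconnected (hclass c)].

End ClassProduct.

(* The vector space with basis B is {freeg B / K}; the tensor product of     *)
(* {freeg B / K} and {freeg C / K} is {freeg (B * C) / K}, where (b, c)      *)
(* stands for the tensor of the basis elements b and c.                      *)

Section FreeSpaces.
Variable K : fieldType.

Definition bas (B : choiceType) (b : B) : {freeg B / K} := << b >>.

Section LinearExtension.
Variables (B : choiceType) (M : lmodType K) (f : B -> M).

Lemma fglift_is_linear : linear (fglift f : {freeg B / K} -> M).
Proof.
have fB : {morph (fglift f : {freeg B / K} -> M) : u v / u - v}.
  exact: lift_is_additive.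
have f0 : fglift f (0 : {freeg B / K}) = 0.
  by rewrite -[0 in LHS](subrr (0 : {freeg B / K})) fB subrr.
have fD : {morph (fglift f : {freeg B / K} -> M) : u v / u + v}.
  by move=> u v; rewrite -[v in LHS]opprK fB -[- v]add0r fB f0 sub0r opprK.
have fZ c (u : {freeg B / K}) : fglift f (c *: u) = c *: fglift f u.
  rewrite -{2}[u]freeg_sumE [c *: u]/(fgscale c u) /fgscale.
  rewrite !(big_morph _ fD f0) scaler_sumr.
  by apply: eq_bigr => x _; rewrite !liftU scalerA.
by move=> c u v; rewrite fD fZ.
Qed.

HB.instance Definition _ := GRing.isLinear.Build K {freeg B / K} M *:%R
  (fglift f) fglift_is_linear.

Definition lin_ext : {linear {freeg B / K} -> M} := fglift f.

Lemma lin_ext_bas b : lin_ext (bas b) = f b.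
Proof. by rewrite /= liftU scale1r. Qed.

End LinearExtension.

Definition tens (B C : choiceType) (u : {freeg B / K}) (v : {freeg C / K}) :
    {freeg (B * C) / K} :=
  lin_ext (fun b => lin_ext (fun c => bas (b, c)) v) u.

Definition tensmap (B B' C C' : choiceType)
    (f : {linear {freeg B / K} -> {freeg B' / K}})
    (g : {linear {freeg C / K} -> {freeg C' / K}}) :
    {linear {freeg (B * C) / K} -> {freeg (B' * C') / K}} :=
  lin_ext (fun p => tens (f (bas p.1)) (g (bas p.2))).

(* phi (x) Id and Id (x) phi for a linear form phi, with K (x) V = V = V (x) K *)
Definition tensforml (B C : choiceType)
    (phi : {linear {freeg B / K} -> K^o}) :
    {linear {freeg (B * C) / K} -> {freeg C / K}} :=
  lin_ext (fun p => phi (bas p.1) *: bas p.2).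

Definition tensformr (B C : choiceType)
    (phi : {linear {freeg C / K} -> K^o}) :
    {linear {freeg (B * C) / K} -> {freeg B / K}} :=
  lin_ext (fun p => phi (bas p.2) *: bas p.1).

(* B (x) (C (x) D) = (B (x) C) (x) D *)
Definition tensA (B C D : choiceType) :
    {linear {freeg (B * (C * D)) / K} -> {freeg (B * C * D) / K}} :=
  lin_ext (fun p => bas (p.1, p.2.1, p.2.2)).

(* {freeg {i & B i} / K} is the direct sum of the {freeg B i / K} *)
Definition dsum_in (I : choiceType) (B : I -> choiceType) (i : I) :
    {linear {freeg (B i) / K} -> {freeg {i : I & B i} / K}} :=
  lin_ext (fun b => bas (Tagged (fun i => B i) b)).

Notation "''H' [ X ]" := {freeg (hypergraph X) / K} (format "''H' [ X ]").
Notation "''H' [ X , Y ]" := {freeg (hypergraph X * hypergraph Y) / K}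
  (format "''H' [ X ,  Y ]").

Definition lrelabel (X Y : finType) (f : X -> Y) (f_bij : bijective f) :
    {linear 'H[X] -> 'H[Y]} :=
  lin_ext (fun G => bas (hrelabel f_bij G)).

Definition Delta (k : restriction_kind) (X Y : finType) :
    {linear 'H[(X + Y)%type] -> 'H[X, Y]} :=
  lin_ext (fun G => tens (bas (hrestr k (@inl_injective X Y) G))
                         (bas (hrestr k (@inr_injective X Y) G))).

Definition delta (k : restriction_kind) (X : finType) (r : eqv X) :
    {linear 'H[X] -> 'H[quo r, X]} :=
  lin_ext (fun G => if eqv_connected k r G
                    then tens (bas (hcontract r G)) (bas (hextract k r G))
                    else 0).

Definition eps_delta (X : finType) : {linear 'H[X] -> K^o} :=
  lin_ext (fun G : hypergraph X => (edges_plus G == set0)%:R : K^o).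

Definition hmul (X Y : finType) :
    {linear 'H[X, Y] -> 'H[(X + Y)%type]} :=
  lin_ext (fun p => bas (hprod p.1 p.2)).

(* (a1 (x) a2) (x) (b1 (x) b2) |-> a1 b1 (x) a2 b2 *)
Definition hmul2 (X X' Y Y' : finType) :
    {linear {freeg ((hypergraph X * hypergraph X') *
                    (hypergraph Y * hypergraph Y')) / K} ->
            'H[(X + Y)%type, (X' + Y')%type]} :=
  lin_ext (fun p => tens (hmul X Y (bas (p.1.1, p.2.1)))
                         (hmul X' Y' (bas (p.1.2, p.2.2)))).

Definition m1_3_24 (X X' Y Y' : finType) :
    {linear {freeg ((hypergraph X * hypergraph X') *
                    (hypergraph Y * hypergraph Y')) / K} ->
            {freeg (hypergraph X * hypergraph Y *
                    hypergraph (X' + Y')%type) / K}} :=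
  lin_ext (fun p => tens (bas (p.1.1, p.2.1))
                         (hmul X' Y' (bas (p.1.2, p.2.2)))).

End FreeSpaces.

Arguments tens {K B C} u v.
Arguments tensmap {K B B' C C'} f g.
Arguments tensforml {K B C} phi.
Arguments tensformr {K B C} phi.
Arguments tensA K {B C D}.
Arguments dsum_in K {I} B i.
Arguments lrelabel K {X Y f} f_bij.
Arguments delta K k {X} r.
Arguments Delta K k X Y.
Arguments eps_delta K X.
Arguments hmul K X Y.
Arguments hmul2 K {X X' Y Y'}.
Arguments m1_3_24 K {X X' Y Y'}.

(* Main.v *)
Require Import Defs.
From mathcomp Require Import all_boot all_order all_algebra.
From mathcomp.multinomials Require Import freeg.

Set Implicit Arguments.
Unset Strict Implicit.
Unset Printing Implicit Defensive.

Import GRing.Theory.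
Local Open Scope ring_scope.

(* Connectedness of every class of r amounts to: r is exactly path            *)
(* connectedness in the extraction G|r. All the sets of equivalences in       *)
(* the statement are thus compared through connectedness of extractions,      *)
(* and the identities between basis elements reduce to three commutations:    *)
(* nested extractions compose, extraction by a coarser r commutes with        *)
(* contraction by a finer r', and both operations split over disjoint unions. *)
(* Contracting connected fibers does not change connectedness, which gives    *)
(* coassociativity. In the counit sums, a trivial contraction G/r forces r to *)
(* be the relation of connected components, and a trivial extraction G|r      *)
(* forces r to be equality.                                                   *)

(** On a basis element, [delta] gives one tensor or zero. Each identity therefore asks two things:
    whether the connectedness conditions on the two sides agree, and whether the resulting
    hypergraphs agree. Expressing restrictions as traces inside a fixed ambient set lets most of the
    argument treat both restriction kinds alike.

    Coassociativity, for [r'] finer than [r]: extracting by [r] and then by [r'] is extracting by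
    [r'] ([hextract_extract]), and (G/r') extracted by the induced relation is (G|r)/r'
    ([hextract_contract]). When the classes of [r'] are connected, collapsing them neither creates
    nor destroys connections ([connect_himage]), so the conditions agree ([eqv_connected_bar]).

    Counit: if the classes of [r] are connected, the paths of G|r recover [r] ([extract_connectE]).
    If G/r is trivial, each edge lies in one class, so G|r = G and [r] is the component relation; if
    G|r is trivial, its paths are constant and [r] is equality. One term survives in each sum.

    Multiplicativity and compatibility: each class of a sum relation lies on one side, so the
    extraction from any G on X + Y is the product of the extractions from its two restrictions
    ([hextract_sum]). For a product these restrictions are the factors. A class meeting both sides
    would need a path across a product, and there is none ([eqv_connected_prod]). *)

Section Connect.
Variables (T U : finType) (f : T -> U) (e : rel T) (e' : rel U).

Lemma connect_homo x y :
  (forall x y, e x y -> connect e' (f x) (f y)) ->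
  connect e x y -> connect e' (f x) (f y).
Proof.
move=> fe /connectP[p]; elim: p x => [|z p IHp] x /= => [_ ->|].
  exact: connect0.
by case/andP=> /fe xz zp /(IHp z zp); apply: connect_trans.
Qed.

(** The image of [f] is closed under [e'], so a path starting in it never leaves it and pulls back
    step by step. *)
Lemma connect_emb x y :
  injective f -> (forall x y, e' (f x) (f y) = e x y) ->
  (forall x u, e' (f x) u -> exists z, u = f z) ->
  connect e' (f x) (f y) = connect e x y.
Proof.
move=> f_inj fe f_closed; apply/idP/idP; last first.
  by apply: connect_homo => a b ab; apply: connect1; rewrite fe.
case/connectP=> p; elim: p x => [|u p IHp] x /= => [_ /f_inj ->|].
  exact: connect0.
case/andP=> xu; have [z uz] := f_closed _ _ xu; rewrite uz => zp yp.
by apply: connect_trans (IHp _ zp yp); apply: connect1; rewrite -fe -uz.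
Qed.

End Connect.

Lemma imset_comp_sets (X Y Z : finType) (f : Y -> Z) (g : X -> Y)
    (E : {set {set X}}) :
  [set f @: e | e : {set Y} in [set g @: e | e : {set X} in E]]
  = [set (f \o g) @: e | e : {set X} in E].
Proof.
apply/setP => e; apply/imsetP/imsetP => [[_ /imsetP[d dE ->] ->]|[d dE ->]].
  by exists d => //; rewrite imset_comp.
by exists (g @: d); [apply/imsetP; exists d | rewrite imset_comp].
Qed.

(** * Edges and adjacency *)

Section Edges.
Variable X : finType.
Implicit Types G : hypergraph X.

Lemma hypergraph_eq G G' : edges G =i edges G' -> G = G'.
Proof. by move=> GG'; apply/val_inj/setP. Qed.

Lemma adj_sym G : symmetric (adj G).
Proof. by move=> x y; apply: eq_existsb => e; rewrite (andbC (x \in e)). Qed.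

Lemma connect_adj_sym G : symmetric (connect (adj G)).
Proof. exact/sym_connect_sym/adj_sym. Qed.

Lemma adjP G x y :
  reflect (exists e, [/\ e \in edges G, x \in e & y \in e]) (adj G x y).
Proof.
apply: (iffP existsP) => [[e /and3P[eG xe ye]]|[e [eG xe ye]]]; exists e => //.
exact/and3P.
Qed.

Lemma edges_plus_eq0 G :
  reflect (forall e x y, e \in edges G -> x \in e -> y \in e -> x = y)
          (edges_plus G == set0).
Proof.
apply: (iffP eqP) => [G0 e x y eG xe ye|Gs].
  apply/eqP; apply: contraFT (in_set0 e) => xy; rewrite -G0 inE eG /=.
  by apply/card_gt1P; exists x, y.
apply/setP => e; rewrite !inE; apply/negP => /andP[eG].
case/card_gt1P=> x [y [xe ye]].
by rewrite (Gs e x y) ?eqxx.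
Qed.

End Edges.

(** * Restrictions as families of subsets of the ambient set *)

Section Trace.
Variables (k : restriction_kind) (X : finType).
Implicit Types (E : {set {set X}}) (C D : {set X}) (G : hypergraph X).

(* The edges of the restriction of kind k to C, as subsets of the ambient set *)
Definition trace E C : {set {set X}} :=
  match k with
  | RCap => [set e :&: C | e : {set X} in E]
  | RSub => [set e in E | e \subset C]
  end.

Lemma trace_sub E C e : e \in trace E C -> e \subset C.
Proof.
rewrite /trace; case: k => [/imsetP[d _ ->]|]; first exact: subsetIr.
by rewrite inE => /andP[].
Qed.

Lemma trace_sup E C e : e \in trace E C -> exists2 d, d \in E & e \subset d.
Proof.
rewrite /trace; case: k => [/imsetP[d dE ->]|]; last first.
  by rewrite inE => /andP[eE _]; exists e.
by exists d => //; apply: subsetIl.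
Qed.

Lemma mem_trace E C e : e \in E -> e \subset C -> e \in trace E C.
Proof.
rewrite /trace => eE eC; case: k; last by rewrite inE eE.
by apply/imsetP; exists e => //; rewrite (setIidPl eC).
Qed.

Lemma trace_trace E C D : D \subset C -> trace (trace E C) D = trace E D.
Proof.
move=> DC; apply/setP => e; rewrite /trace; case: k; last first.
  rewrite !inE -andbA; case: (boolP (e \subset D)) => [eD|]; rewrite ?andbF //.
  by rewrite (subset_trans eD DC).
apply/imsetP/imsetP => [[_ /imsetP[d dE ->] ->]|[d dE ->]].
  by exists d => //; rewrite -setIA (setIidPr DC).
exists (d :&: C); first by apply/imsetP; exists d.
by rewrite -setIA (setIidPr DC).
Qed.

(** Removes subtypes and injections: restrictions to different vertex types become comparable inside
    [X]. *)
Lemma trace_restr (I : finType) (f : I -> X) (E : {set {set X}}) :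
  injective f ->
  [set f @: e | e : {set I} in restr_edges k f E] = trace E (f @: setT).
Proof.
move=> f_inj; apply/setP => e; rewrite /trace /restr_edges; case: k.
  have fK (d : {set X}) : f @: (f @^-1: d) = d :&: f @: setT.
    apply/setP => x; rewrite inE.
    apply/imsetP/andP => [[i]|[xd /imsetP[i _ xi]]].
      by rewrite inE => fi ->; split=> //; apply: imset_f.
    by exists i => //; rewrite inE -xi.
  apply/imsetP/imsetP => [[_ /imsetP[d dE ->] ->]|[d dE ->]].
    by exists d.
  by exists (f @^-1: d) => //; apply/imsetP; exists d.
rewrite inE; apply/imsetP/andP => [[d]|[eE /subsetP eC]].
  by rewrite inE => dE ->; split=> //; apply: imsetS; apply: subsetT.
have fK : f @: (f @^-1: e) = e.
  apply/setP => x; apply/imsetP/idP => [[i]|xe]; first by rewrite inE => ? ->.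
  by have /imsetP[i _ xi] := eC x xe; exists i => //; rewrite inE -xi.
by exists (f @^-1: e) => //; rewrite inE fK.
Qed.

End Trace.

(** * Extraction and connectedness of classes *)

Section Extract.
Variables (k : restriction_kind) (X : finType).
Implicit Types (r : eqv X) (G : hypergraph X) (C D : {set X}).

Definition rclass r x : {set X} := [set y | r x y].

Lemma rclass_eq r x y : r x y -> rclass r x = rclass r y.
Proof.
move=> xy; apply/setP => z; rewrite !inE; apply/idP/idP; apply: eqv_trans => //.
by rewrite eqv_sym.
Qed.

Lemma mem_extract r G e :
  reflect (e = set0 \/ exists x, e \in trace k (edges G) (rclass r x))
          (e \in edges (hextract k r G)).
Proof.
have valT (c : quo r) :
    val @: [set: {x | x \in class_set c}] = rclass r (repr c).
  apply/setP => y; rewrite inE -cls_eq cls_repr eq_sym.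
  apply/imsetP/eqP => [[z _ ->]|cy].
    by have := valP z; rewrite inE => /eqP.
  by have yP : y \in class_set c; [rewrite inE cy | exists (Sub y yP)].
apply: (iffP idP); rewrite /= /hextract_edges !inE.
  case/orP=> [/eqP|/bigcupP[c _]].
    by left.
  rewrite trace_restr ?valT => [ec|]; last exact: val_inj.
  by right; exists (repr c).
case=> [->|[x ex]]; first by rewrite eqxx.
apply/orP; right; apply/bigcupP; exists (cls r x) => //.
rewrite trace_restr ?valT; last exact: val_inj.
by rewrite (rclass_eq (repr_cls r x)).
Qed.

Lemma adj_extract_eqv r G x y : adj (hextract k r G) x y -> r x y.
Proof.
case/adjP=> e [/mem_extract[->|[z /trace_sub/subsetP ez]]]; first by rewrite inE.
by move=> /ez; rewrite !inE eqv_sym => xz /ez; rewrite inE; apply: eqv_trans.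
Qed.

Lemma adj_extract r G : subrel (adj (hextract k r G)) (adj G).
Proof.
move=> x y /adjP[e [/mem_extract[->|[z /trace_sup[d dG /subsetP ed]]]]].
  by rewrite inE.
by move=> /ed xd /ed yd; apply/adjP; exists d.
Qed.

Lemma connect_extract_eqv r G x y : connect (adj (hextract k r G)) x y -> r x y.
Proof.
case/connectP=> p; elim: p x => [|z p IHp] x /= => [_ ->|].
  exact: eqv_refl.
by case/andP=> /adj_extract_eqv xz zp /(IHp z zp); apply: eqv_trans.
Qed.

Lemma cls_val r (c : quo r) (u : {x | x \in class_set c}) : cls r (val u) = c.
Proof. by case: u => x /= xc; move: (xc); rewrite inE => /eqP. Qed.

Lemma adj_class r G (c : quo r) (u v : {x | x \in class_set c}) :
  adj (hclass k G c) u v = adj (hextract k r G) (val u) (val v).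
Proof.
apply/adjP/adjP => -[e [eG ue ve]].
  exists (val @: e); split; try exact: imset_f.
  rewrite /= /hextract_edges inE; apply/orP; right.
  by apply/bigcupP; exists c => //; apply: imset_f.
move: eG; rewrite /= /hextract_edges !inE => /orP[/eqP e0|/bigcupP[d _]].
  by rewrite e0 inE in ue.
case/imsetP=> e' e'G ee'; have cd : d = c.
  by move: ue; rewrite ee' => /imsetP[w _ uw]; rewrite -(cls_val w) -uw cls_val.
subst d; exists e'; split=> //.
  by move: ue; rewrite ee' (mem_imset _ _ val_inj).
by move: ve; rewrite ee' (mem_imset _ _ val_inj).
Qed.

Lemma eqv_connectedP r G :
  reflect (forall x y, r x y -> connect (adj (hextract k r G)) x y)
          (eqv_connected k r G).
Proof.
(* Adjacency in the extraction never leaves a class, so paths inside a class are exactly the ambient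
   paths between its points. *)
have cE (c : quo r) (u v : {x | x \in class_set c}) :
    connect (adj (hextract k r G)) (val u) (val v)
    = connect (adj (hclass k G c)) u v.
  apply: connect_emb => [|a b|a z]; first exact: val_inj.
    by rewrite adj_class.
  move=> /adj_extract_eqv az; have zc : z \in class_set c.
    by have := valP a; rewrite !inE => /eqP <-; rewrite cls_eq eqv_sym.
  by exists (Sub z zc).
apply: (iffP forallP) => [conn x y xy|conn c].
  have xP : x \in class_set (cls r y) by rewrite inE cls_eq.
  have yP : y \in class_set (cls r y) by rewrite inE.
  rewrite (cE _ (Sub x xP) (Sub y yP)).
  by have /forallP/(_ (Sub x xP))/forallP/(_ (Sub y yP)) := conn (cls r y).
apply/forallP => u; apply/forallP => v; rewrite -cE; apply: conn.
by rewrite -cls_eq !cls_val.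
Qed.

Lemma extract_connectE r G x y :
  eqv_connected k r G -> connect (adj (hextract k r G)) x y = r x y.
Proof.
move=> /eqv_connectedP conn; apply/idP/idP => [|/conn //].
exact: connect_extract_eqv.
Qed.

Lemma set0_trace G C : set0 \in trace k (edges G) C.
Proof. by apply: mem_trace; [apply: edges0 | apply: sub0set]. Qed.

Lemma rclass_mem r x y (e : {set X}) :
  e \subset rclass r x -> y \in e -> rclass r x = rclass r y.
Proof. by move=> /subsetP ex /ex; rewrite inE; apply: rclass_eq. Qed.

(** A nonempty edge of the extraction that meets the class of [x] lies in it and is already a trace
    of [G] there; the other classes contribute only the empty set. *)
Lemma trace_extract r G x D :
  D \subset rclass r x ->
  trace k (edges (hextract k r G)) D = trace k (edges G) D.
Proof.
(* Tracing on the whole class first reduces the claim to [D] being that class. *)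
move=> Dx; rewrite -[LHS](trace_trace _ _ Dx) -[RHS](trace_trace _ _ Dx).
congr trace; apply/setP => e; apply/idP/idP => [eC|eC]; last first.
  by apply: mem_trace (trace_sub eC); apply/mem_extract; right; exists x.
have [->|[y ye]] := set_0Vmem e; first exact: set0_trace.
have Cy := rclass_mem (trace_sub eC) ye.
have yG d : d \in edges (hextract k r G) -> y \in d ->
    d \in trace k (edges G) (rclass r x).
  case/mem_extract=> [->|[z dz]] yd; first by rewrite inE in yd.
  by rewrite Cy -(rclass_mem (trace_sub dz) yd).
case: (k) yG eC => yG; rewrite {1}/trace; last first.
  by rewrite inE => /andP[/yG/(_ ye)].
case/imsetP=> d /yG dG ed; have /dG dC : y \in d.
  by move: ye; rewrite ed inE => /andP[].
by rewrite ed (setIidPl (trace_sub dC)).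
Qed.

Lemma hextract_extract r r' G :
  eqv_le r r' -> hextract k r' (hextract k r G) = hextract k r' G.
Proof.
move=> le_rr'; apply: hypergraph_eq => e.
have tr x : trace k (edges (hextract k r G)) (rclass r' x)
    = trace k (edges G) (rclass r' x).
  apply: (@trace_extract _ _ x); apply/subsetP => y.
  by rewrite !inE; apply: le_rr'.
by apply/mem_extract/mem_extract => -[->|[x ex]]; try (by left);
  right; exists x; rewrite ?tr // -tr.
Qed.

Lemma hextract_id G r :
  (forall e x y, e \in edges G -> x \in e -> y \in e -> r x y) ->
  hextract k r G = G.
Proof.
move=> Gr; apply: hypergraph_eq => e; apply/mem_extract/idP => [|eG].
  case=> [->|[x ex]]; first exact: edges0.
  have [->|[y ye]] := set_0Vmem e; first exact: edges0.
  have Cy := rclass_mem (trace_sub ex) ye; move: ex; rewrite Cy.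
  rewrite /trace; case: (k) => [/imsetP[d dG ed]|]; last by rewrite inE => /andP[].
  suff -> : e = d by [].
  rewrite ed; apply/setIidPl/subsetP => z zd; rewrite inE; apply: Gr zd => //.
  by move: ye; rewrite ed inE => /andP[].
have [->|[x xe]] := set_0Vmem e; [by left | right; exists x].
by apply: mem_trace => //; apply/subsetP => y ye; rewrite inE; apply: Gr ye.
Qed.

End Extract.

(** * Contraction and its commutation with extraction *)

Section Contract.
Variables (k : restriction_kind) (X : finType).
Implicit Types (r : eqv X) (G : hypergraph X) (C D : {set X}).

(** An edge of the image lifts to an edge of [G] whose endpoints are right only up to the fibers of
    [f]; connected fibers allow the lifted edges to be joined into a path. *)
Lemma connect_himage (Y : finType) (f : X -> Y)
    (f_surj : forall y, exists x, f x = y) G x y :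
  (forall x y, f x = f y -> connect (adj G) x y) ->
  connect (adj (himage f_surj G)) (f x) (f y) = connect (adj G) x y.
Proof.
move=> fib; apply/idP/idP; last first.
  apply: connect_homo => a b /adjP[e [eG ae be]]; apply/connect1/adjP.
  by exists (f @: e); split; rewrite /= ?imset_f.
have gP y0 : exists x, f x == y0 by have [x0 <-] := f_surj y0; exists x0.
(* A section of [f], along which paths of the image are lifted. *)
pose g y0 := xchoose (gP y0).
have gK y0 : f (g y0) = y0 by apply/eqP/(xchooseP (gP y0)).
move=> /(@connect_homo _ _ g _ (adj G)) cg.
apply: connect_trans (fib x (g (f x)) _) _; rewrite ?gK //.
apply: connect_trans _ (fib (g (f y)) y _); rewrite ?gK //.
apply: cg => a b /adjP[_ [/imsetP[e eG ->] /imsetP[c ce ->] /imsetP[d de ->]]].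
apply: connect_trans (fib _ c _) _; rewrite ?gK //.
apply: connect_trans _ (fib d _ _); rewrite ?gK //.
by apply/connect1/adjP; exists e.
Qed.

(** Here [C] is the full preimage of [D], so intersecting with [D], or lying in [D], can be tested
    before applying [f]. *)
Lemma trace_imset (Y : finType) (f : X -> Y) (E : {set {set X}}) C (D : {set Y}) :
  (forall x, (f x \in D) = (x \in C)) ->
  trace k [set f @: e | e : {set X} in E] D
  = [set f @: e | e : {set X} in trace k E C].
Proof.
move=> fC; apply/setP => e; rewrite /trace; case: (k).
  have fI (d : {set X}) : f @: d :&: D = f @: (d :&: C).
    apply/setP => y; rewrite inE; apply/andP/imsetP.
      by case=> /imsetP[x xd ->]; rewrite fC => xC; exists x; rewrite // inE xd.
    by case=> x; rewrite inE => /andP[xd xC] ->; rewrite fC imset_f.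
  apply/imsetP/imsetP => [[_ /imsetP[d dE ->] ->]|[_ /imsetP[d dE ->] ->]].
    by exists (d :&: C); [apply/imsetP; exists d | rewrite fI].
  by exists (f @: d); [apply/imsetP; exists d | rewrite fI].
have fS (d : {set X}) : (f @: d \subset D) = (d \subset C).
  apply/subsetP/subsetP => [dD x xd|dC _ /imsetP[x xd ->]].
    by rewrite -fC dD // imset_f.
  by rewrite fC dC.
rewrite inE; apply/andP/imsetP => [[/imsetP[d dE ->]]|[d]].
  by rewrite fS => dC; exists d; rewrite // inE dE.
by rewrite inE => /andP[dE dC] ->; rewrite fS imset_f.
Qed.

(** The preimage in [X] of a class of the induced relation is a class of [r], so [trace_imset]
    applies class by class. *)
Lemma hextract_contract r r' G :
  eqv_le r r' ->
  hextract k (eqv_bar r r') (hcontract r' G) = hcontract r' (hextract k r G).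
Proof.
move=> le_rr'; apply: hypergraph_eq => e.
have tr x : trace k (edges (hcontract r' G)) (rclass (eqv_bar r r') (cls r' x))
    = [set cls r' @: d | d : {set X} in trace k (edges G) (rclass r x)].
  by apply: trace_imset => y; rewrite !inE eqv_barE.
apply/mem_extract/imsetP => [[->|[c]]|[d /mem_extract[->|[x dx]] ->]].
- by exists set0; rewrite ?edges0 ?imset0.
- have [x <-] := cls_surj c; rewrite tr => /imsetP[d dG ->].
  by exists d => //; apply/mem_extract; right; exists x.
- by left; rewrite imset0.
by right; exists (cls r' x); rewrite tr imset_f.
Qed.

Lemma eqv_connected_bar r r' G :
  eqv_le r r' ->
  eqv_connected k r' G && eqv_connected k (eqv_bar r r') (hcontract r' G)
  = eqv_connected k r G && eqv_connected k r' (hextract k r G).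
Proof.
move=> le_rr'.
have -> : eqv_connected k r' (hextract k r G) = eqv_connected k r' G.
  by apply/eqv_connectedP/eqv_connectedP; rewrite hextract_extract.
rewrite andbC; apply: andb_id2r => conn'.
(* Points of one class of [r'] are joined in G|r', which is an extraction of G|r and so has no
   adjacency that G|r lacks. *)
have fib x y : cls r' x = cls r' y -> connect (adj (hextract k r G)) x y.
  move/eqP; rewrite cls_eq -(extract_connectE _ _ conn').
  rewrite -(hextract_extract k G le_rr').
  apply: connect_sub => a b ab; apply: connect1; exact: adj_extract ab.
apply/eqv_connectedP/eqv_connectedP => conn.
  move=> x y xy; rewrite -(connect_himage (@cls_surj _ r') _ _ fib).
  by rewrite -[himage _ _]/(hcontract r' _) -hextract_contract // conn ?eqv_barE.
move=> c d; have [x <-] := cls_surj c; have [y <-] := cls_surj d.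
rewrite eqv_barE // hextract_contract // => /conn.
by rewrite (connect_himage (@cls_surj _ r') _ _ fib).
Qed.

Lemma hcontract_contract r r' (le_rr' : eqv_le r r') G :
  hrelabel (bar_iso_bij le_rr') (hcontract (eqv_bar r r') (hcontract r' G))
  = hcontract r G.
Proof.
apply/val_inj; rewrite /= !imset_comp_sets; apply: eq_imset => e.
by apply: eq_imset => x /=; rewrite bar_isoE.
Qed.

End Contract.

(** * Restrictions under images and disjoint unions *)

Section Restr.
Variable k : restriction_kind.

Lemma mem_restr_edges (I X : finType) (f : I -> X) (E : {set {set X}}) e :
  injective f ->
  (e \in restr_edges k f E) = (f @: e \in trace k E (f @: setT)).
Proof.
by move=> f_inj; rewrite -trace_restr // mem_imset //; apply: imset_inj.
Qed.

Lemma trace_restr_edges (I X : finType) (f : I -> X) (E : {set {set X}})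
    (C : {set I}) :
  injective f ->
  [set f @: e | e : {set I} in trace k (restr_edges k f E) C]
  = trace k E (f @: C).
Proof.
move=> f_inj; rewrite -(@trace_imset _ _ _ f _ C (f @: C)).
  by rewrite trace_restr // trace_trace //; apply/imsetS/subsetT.
by move=> i; rewrite mem_imset.
Qed.

(** Serves to restrict a contraction to one summand. The last hypothesis makes the image of [f] the
    full preimage under [h] of the image of [f']. *)
Lemma restr_edges_imset (I I' X X' : finType) (f : I -> X) (f' : I' -> X')
    (h : X -> X') (p : I -> I') (E : {set {set X}}) :
  injective f -> injective f' -> h \o f =1 f' \o p ->
  (forall x, (h x \in f' @: setT) = (x \in f @: setT)) ->
  restr_edges k f' [set h @: e | e : {set X} in E]
  = [set p @: e | e : {set I} in restr_edges k f E].
Proof.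
move=> f_inj f'_inj hf hfT; apply/setP => e.
rewrite mem_restr_edges // (trace_imset _ _ hfT) -trace_restr //.
rewrite imset_comp_sets -(mem_imset _ e (imset_inj f'_inj)) imset_comp_sets.
have hfS (d : {set I}) : (h \o f) @: d = (f' \o p) @: d by apply: eq_imset.
by rewrite (eq_imset _ hfS).
Qed.

Lemma trace_union (X Y Z : finType) (f : X -> Z) (g : Y -> Z)
    (A : hypergraph X) (B : hypergraph Y) (e : {set X}) :
  injective f -> (forall x y, f x <> g y) ->
  (f @: e \in trace k ([set f @: a | a : {set X} in edges A]
                   :|: [set g @: b | b : {set Y} in edges B]) (f @: setT))
  = (e \in edges A).
Proof.
move=> f_inj fg; apply/idP/idP => [|eA]; last first.
  by apply: mem_trace; [rewrite inE imset_f | apply/imsetS/subsetT].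
(* The empty edge lies in every hypergraph; otherwise a point of [e] rules out the edges coming from
   [g]. *)
have [->|[x xe]] := set_0Vmem e; first by rewrite edges0.
have fx : f x \in f @: e by apply: imset_f.
rewrite /trace; case: k => [/imsetP[d]|]; rewrite !inE.
  case/orP=> /imsetP[a aA ->] fe.
    move: fe; rewrite (setIidPl _); last exact/imsetS/subsetT.
    by move/(imset_inj f_inj) ->.
  by move: fx; rewrite fe inE => /andP[/imsetP[y _ /fg]].
case/andP=> /orP[] /imsetP[a aA fe] _; first by rewrite (imset_inj f_inj fe).
by move: fx; rewrite fe => /imsetP[y _ /fg].
Qed.

End Restr.

(** * Disjoint unions of vertex sets *)

Section Sum.
Variables (k : restriction_kind) (X Y : finType) (rX : eqv X) (rY : eqv Y).
Implicit Types (G : hypergraph (X + Y)%type).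
Implicit Types (A : hypergraph X) (B : hypergraph Y).

Local Notation restl := (hrestr k (@inl_injective X Y)).
Local Notation restr := (hrestr k (@inr_injective X Y)).

Lemma restl_prod A B : restl (hprod A B) = A.
Proof.
apply: hypergraph_eq => e; rewrite mem_restr_edges; last exact: inl_injective.
by apply: trace_union => //; apply: inl_injective.
Qed.

Lemma restr_prod A B : restr (hprod A B) = B.
Proof.
apply: hypergraph_eq => e; rewrite mem_restr_edges; last exact: inr_injective.
by rewrite /= setUC; apply: trace_union => //; apply: inr_injective.
Qed.

Lemma hextract_sum G :
  hextract k (eqv_sum rX rY) G
  = hprod (hextract k rX (restl G)) (hextract k rY (restr G)).
Proof.
have cX x : rclass (eqv_sum rX rY) (inl x) = inl @: rclass rX x.
  apply/setP => -[y|y]; rewrite inE mk_eqvE /=.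
    by rewrite (mem_imset _ _ (@inl_injective _ _)) inE.
  by apply/esym/imsetP => -[].
have cY y : rclass (eqv_sum rX rY) (inr y) = inr @: rclass rY y.
  apply/setP => -[x|x]; rewrite inE mk_eqvE /=.
    by apply/esym/imsetP => -[].
  by rewrite (mem_imset _ _ (@inr_injective _ _)) inE.
apply: hypergraph_eq => e; rewrite [in RHS]inE; apply/mem_extract/orP.
  case=> [->|[[x|y]]].
  - by left; apply/imsetP; exists set0; rewrite ?edges0 ?imset0.
  - rewrite cX -(trace_restr_edges _ _ _ (@inl_injective _ _)).
    move=> /imsetP[a aA ->]; left; apply: imset_f.
    by apply/mem_extract; right; exists x.
  rewrite cY -(trace_restr_edges _ _ _ (@inr_injective _ _)).
  move=> /imsetP[b bB ->]; right; apply: imset_f.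
  by apply/mem_extract; right; exists y.
case=> /imsetP[a /mem_extract[->|[x ax]] ->]; rewrite ?imset0; try by left.
  right; exists (inl x); rewrite cX -(trace_restr_edges _ _ _ (@inl_injective _ _)).
  exact: imset_f.
right; exists (inr x); rewrite cY -(trace_restr_edges _ _ _ (@inr_injective _ _)).
exact: imset_f.
Qed.

Lemma adj_prod A B u v :
  adj (hprod A B) u v =
  match u, v with
  | inl x, inl x' => adj A x x'
  | inr y, inr y' => adj B y y'
  | _, _ => false
  end.
Proof.
apply/adjP/idP => [[e []]|].
  rewrite inE => /orP[] /imsetP[a aA ->] /imsetP[x xa ->] /imsetP[y ya ->];
    by apply/adjP; exists a.
case: u v => x [] y // /adjP[a [aA xa ya]].
  by exists (inl @: a); split; rewrite ?inE ?imset_f.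
by exists (inr @: a); split; rewrite ?inE ?imset_f ?orbT.
Qed.

Lemma connect_prod A B u v :
  connect (adj (hprod A B)) u v =
  match u, v with
  | inl x, inl x' => connect (adj A) x x'
  | inr y, inr y' => connect (adj B) y y'
  | _, _ => false
  end.
Proof.
(* The left summand is closed under adjacency, so no path crosses sides. *)
pose a := [pred w : X + Y | if w is inl _ then true else false].
have a_closed : closed (adj (hprod A B)) a.
  by move=> [x|x] [y|y]; rewrite adj_prod.
have aE := closed_connect a_closed.
case: u v => [x|x] [y|y].
- apply: connect_emb => [|z t|z [t|t]]; rewrite ?adj_prod //.
    exact: inl_injective.
  by exists t.
- by apply/negP => /aE.
- by apply/negP => /aE.
- apply: connect_emb => [|z t|z [t|t]]; rewrite ?adj_prod //.
    exact: inr_injective.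
  by exists t.
Qed.

Lemma eqv_connected_sum G :
  eqv_connected k (eqv_sum rX rY) G
  = eqv_connected k rX (restl G) && eqv_connected k rY (restr G).
Proof.
apply/eqv_connectedP/andP => [conn|].
  split; apply/eqv_connectedP => x y xy.
    by have := conn (inl x) (inl y); rewrite hextract_sum connect_prod mk_eqvE; apply.
  by have := conn (inr x) (inr y); rewrite hextract_sum connect_prod mk_eqvE; apply.
case=> /eqv_connectedP connX /eqv_connectedP connY u v.
rewrite hextract_sum connect_prod mk_eqvE.
by case: u v => x [] y //; [apply: connX | apply: connY].
Qed.

Lemma eqv_connected_prod A B (r : eqv (X + Y)%type) :
  eqv_connected k r (hprod A B) ->
  forall u v, r u v -> match u, v with
                       | inl _, inl _ | inr _, inr _ => true
                       | _, _ => false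
                       end.
Proof.
move=> /eqv_connectedP conn u v /conn.
have /connect_sub : subrel (adj (hextract k r (hprod A B)))
    (connect (adj (hprod A B))).
  by move=> a b /adj_extract; apply: connect1.
by move/[apply]; rewrite connect_prod; case: u v => x [].
Qed.

Local Notation siso := (sum_iso_bij rX rY).

Lemma restl_contract G :
  hrestr k (@inl_injective _ _) (hrelabel siso (hcontract (eqv_sum rX rY) G))
  = hcontract rX (restl G).
Proof.
apply/val_inj; rewrite /= imset_comp_sets.
apply: restr_edges_imset => [||x|u] /=; try exact: inl_injective.
  by rewrite sum_isoE.
rewrite sum_isoE; case: u => x; apply/imsetP/imsetP => -[] // y.
  by exists x.
by exists (cls rX x).
Qed.

Lemma restr_contract G :
  hrestr k (@inr_injective _ _) (hrelabel siso (hcontract (eqv_sum rX rY) G))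
  = hcontract rY (restr G).
Proof.
apply/val_inj; rewrite /= imset_comp_sets.
apply: restr_edges_imset => [||x|u] /=; try exact: inr_injective.
  by rewrite sum_isoE.
rewrite sum_isoE; case: u => x; apply/imsetP/imsetP => -[] // y.
  by exists x.
by exists (cls rY x).
Qed.

Lemma hcontract_prod A B :
  hrelabel siso (hcontract (eqv_sum rX rY) (hprod A B))
  = hprod (hcontract rX A) (hcontract rY B).
Proof.
apply/val_inj; rewrite /= imsetU imsetU !imset_comp_sets.
by congr (_ :|: _); apply: eq_imset => e; apply: eq_imset => x /=;
  rewrite sum_isoE.
Qed.

End Sum.

Lemma eqv_ext (X : finType) (r r' : eqv X) :
  (forall x y, r x y = r' x y) -> r = r'.
Proof. by move=> rr'; apply/val_inj/ffunP => -[x y]; apply: rr'. Qed.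

(** * The equivalences surviving in the counit sums *)

Section Counit.
Variables (k : restriction_kind) (X : finType).
Implicit Types (r : eqv X) (G : hypergraph X).

Definition components G : eqv X :=
  mk_eqv (@connect0 _ (adj G)) (@connect_adj_sym X G) (@connect_trans _ (adj G)).

Lemma contract_trivialP r G :
  reflect (forall e x y, e \in edges G -> x \in e -> y \in e -> r x y)
          (edges_plus (hcontract r G) == set0).
Proof.
apply: (iffP (edges_plus_eq0 _)) => [Gs e x y eG xe ye|Gs].
  by rewrite -cls_eq; apply/eqP; apply: (Gs (cls r @: e)); rewrite ?imset_f.
move=> _ _ _ /imsetP[e eG ->] /imsetP[x xe ->] /imsetP[y ye ->].
by apply/eqP; rewrite cls_eq; apply: Gs ye.
Qed.

Lemma components_extract G : hextract k (components G) G = G.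
Proof.
apply: hextract_id => e x y eG xe ye; rewrite mk_eqvE.
by apply/connect1/adjP; exists e.
Qed.

Lemma components_connected G : eqv_connected k (components G) G.
Proof. by apply/eqv_connectedP => x y; rewrite components_extract mk_eqvE. Qed.

Lemma components_contract G : edges_plus (hcontract (components G) G) == set0.
Proof.
apply/contract_trivialP => e x y eG xe ye; rewrite mk_eqvE.
by apply/connect1/adjP; exists e.
Qed.

(** Triviality of G/r puts every edge inside a class, hence G|r = G, and connectedness of the
    classes identifies [r] with path connectedness in [G]. *)
Lemma componentsP r G :
  eqv_connected k r G -> edges_plus (hcontract r G) == set0 -> r = components G.
Proof.
move=> conn /contract_trivialP Gr; apply: eqv_ext => x y; rewrite mk_eqvE.
by rewrite -(extract_connectE _ _ conn) hextract_id.
Qed.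

Lemma eqv_eq_connected G : eqv_connected k (eqv_eq X) G.
Proof.
by apply/eqv_connectedP => x y; rewrite mk_eqvE => /eqP ->; apply: connect0.
Qed.

Lemma eqv_eq_extract G : edges_plus (hextract k (eqv_eq X) G) == set0.
Proof.
apply/edges_plus_eq0 => e x y eG xe ye.
have : adj (hextract k (eqv_eq X) G) x y by apply/adjP; exists e.
by move/adj_extract_eqv; rewrite mk_eqvE => /eqP.
Qed.

Lemma eqv_eqP r G :
  eqv_connected k r G -> edges_plus (hextract k r G) == set0 -> r = eqv_eq X.
Proof.
move=> conn /edges_plus_eq0 Gs; apply: eqv_ext => x y; rewrite mk_eqvE.
rewrite -(extract_connectE _ _ conn); apply/idP/eqP => [|->]; last exact: connect0.
case/connectP=> p; elim: p x => [|z p IHp] x /= => [_ ->|] //.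
by case/andP=> /adjP[e [eG xe ze]] zp yp; rewrite (Gs e x z eG xe ze); apply: IHp.
Qed.

Lemma hcontract_eq G : hcontract (eqv_eq X) G = hrelabel (cls_eq_bij X) G.
Proof. exact: val_inj. Qed.

End Counit.

Lemma eqv_sum_split (X Y : finType) (r : eqv (X + Y)%type) :
  (forall x y, ~~ r (inl x) (inr y)) -> exists rX rY, r = eqv_sum rX rY.
Proof.
move=> rXY.
pose rX : eqv X := mk_eqv (fun x => eqv_refl r (inl x))
  (fun x y => eqv_sym r (inl x) (inl y))
  (fun y x z => @eqv_trans _ r (inl y) (inl x) (inl z)).
pose rY : eqv Y := mk_eqv (fun x => eqv_refl r (inr x))
  (fun x y => eqv_sym r (inr x) (inr y))
  (fun y x z => @eqv_trans _ r (inr y) (inr x) (inr z)).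
exists rX, rY; apply: eqv_ext => u v; rewrite mk_eqvE.
case: u v => x [] y /=; rewrite ?mk_eqvE //; first exact/negbTE.
by rewrite eqv_sym; apply/negbTE.
Qed.

(** * Evaluation on basis elements and the four identities *)

Section Linear.
Variable K : fieldType.

Section Tensor.
Variables (B B' C C' D : choiceType).
Implicit Types (b : B) (c : C).

Lemma tens_bas b c : tens (bas K b) (bas K c) = bas K (b, c).
Proof. by rewrite /tens !lin_ext_bas. Qed.

Lemma tens0l (v : {freeg C / K}) : tens (0 : {freeg B / K}) v = 0.
Proof. by rewrite /tens linear0. Qed.

Lemma tens_bas0 b : tens (bas K b) (0 : {freeg C / K}) = 0.
Proof. by rewrite /tens lin_ext_bas linear0. Qed.

Lemma tensmap_bas (f : {linear {freeg B / K} -> {freeg B' / K}})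
    (g : {linear {freeg C / K} -> {freeg C' / K}}) b c :
  tensmap f g (bas K (b, c)) = tens (f (bas K b)) (g (bas K c)).
Proof. by rewrite /tensmap lin_ext_bas. Qed.

Lemma tensforml_bas (phi : {linear {freeg B / K} -> K^o}) b c :
  tensforml phi (bas K (b, c)) = phi (bas K b) *: bas K c.
Proof. by rewrite /tensforml lin_ext_bas. Qed.

Lemma tensformr_bas (phi : {linear {freeg C / K} -> K^o}) b c :
  tensformr phi (bas K (b, c)) = phi (bas K c) *: bas K b.
Proof. by rewrite /tensformr lin_ext_bas. Qed.

Lemma tensA_bas b c (d : D) : tensA K (bas K (b, (c, d))) = bas K (b, c, d).
Proof. by rewrite /tensA lin_ext_bas. Qed.

End Tensor.

Lemma lrelabel_bas (X Y : finType) (f : X -> Y) (f_bij : bijective f) G :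
  lrelabel K f_bij (bas K G) = bas K (hrelabel f_bij G).
Proof. by rewrite /lrelabel lin_ext_bas. Qed.

Lemma delta_bas k (X : finType) (r : eqv X) G :
  delta K k r (bas K G)
  = if eqv_connected k r G then bas K (hcontract r G, hextract k r G) else 0.
Proof. by rewrite /delta lin_ext_bas tens_bas. Qed.

Lemma Delta_bas k (X Y : finType) G :
  Delta K k X Y (bas K G)
  = bas K (hrestr k (@inl_injective X Y) G, hrestr k (@inr_injective X Y) G).
Proof. by rewrite /Delta lin_ext_bas tens_bas. Qed.

Lemma eps_delta_bas (X : finType) (G : hypergraph X) :
  eps_delta K X (bas K G) = (edges_plus G == set0)%:R.
Proof. by rewrite /eps_delta lin_ext_bas. Qed.

Lemma hmul_bas (X Y : finType) (A : hypergraph X) (B : hypergraph Y) :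
  hmul K X Y (bas K (A, B)) = bas K (hprod A B).
Proof. by rewrite /hmul lin_ext_bas. Qed.

Lemma hmul2_bas (X X' Y Y' : finType) (A : hypergraph X) (A' : hypergraph X')
    (B : hypergraph Y) (B' : hypergraph Y') :
  hmul2 K (bas K ((A, A'), (B, B'))) = bas K (hprod A B, hprod A' B').
Proof. by rewrite /hmul2 lin_ext_bas /= !hmul_bas tens_bas. Qed.

Lemma m1_3_24_bas (X X' Y Y' : finType) (A : hypergraph X) (A' : hypergraph X')
    (B : hypergraph Y) (B' : hypergraph Y') :
  m1_3_24 K (bas K ((A, A'), (B, B'))) = bas K (A, B, hprod A' B').
Proof. by rewrite /m1_3_24 lin_ext_bas /= !hmul_bas tens_bas. Qed.

Variable k : restriction_kind.

Lemma delta_coassoc (X : finType) (G : hypergraph X) (r r' : eqv X)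
    (le_rr' : eqv_le r r') :
  tensmap (tensmap (lrelabel K (bar_iso_bij le_rr')) idfun) idfun
    (tensmap (delta K k (eqv_bar r r')) idfun (delta K k r' (bas K G)))
  = tensA K (tensmap idfun (delta K k r') (delta K k r (bas K G))).
Proof.
(* Each side is brought to one conjunction guarding one basis triple; [eqv_connected_bar] then
   matches the guards. *)
have -> : tensmap idfun (delta K k r') (delta K k r (bas K G))
    = if eqv_connected k r G && eqv_connected k r' (hextract k r G)
      then bas K (hcontract r G, (hcontract r' (hextract k r G), hextract k r' G))
      else 0.
  rewrite delta_bas; case: ifP => _; last by rewrite linear0.
  rewrite tensmap_bas delta_bas hextract_extract //.
  by case: ifP => _; rewrite ?tens_bas ?tens_bas0.
have -> : tensmap (delta K k (eqv_bar r r')) idfun (delta K k r' (bas K G))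
    = if eqv_connected k r' G && eqv_connected k (eqv_bar r r') (hcontract r' G)
      then bas K (hcontract (eqv_bar r r') (hcontract r' G),
                  hcontract r' (hextract k r G), hextract k r' G)
      else 0.
  rewrite delta_bas; case: ifP => _; last by rewrite linear0.
  rewrite tensmap_bas delta_bas hextract_contract //.
  by case: ifP => _; rewrite ?tens_bas ?tens0l.
rewrite eqv_connected_bar //; case: ifP => _; last by rewrite !linear0.
rewrite tensA_bas !tensmap_bas lrelabel_bas hcontract_contract /=.
by rewrite !tens_bas.
Qed.

Lemma delta_counitl (X : finType) (G : hypergraph X) :
  \sum_(r : eqv X) tensforml (eps_delta K (quo r)) (delta K k r (bas K G))
  = bas K G.
Proof.
rewrite (bigD1 (components G)) //= big1 => [|r rG].
  rewrite delta_bas components_connected tensforml_bas eps_delta_bas.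
  by rewrite components_contract components_extract scale1r addr0.
rewrite delta_bas; case: ifP => [conn|_]; last by rewrite linear0.
rewrite tensforml_bas eps_delta_bas; case: eqP => [/eqP Gr|_].
  by case/eqP: rG; apply: componentsP conn Gr.
by rewrite scale0r.
Qed.

(** The terms live in different spaces, one per quotient, so the sum is taken in their direct sum.
    In the surviving summand, [G] is relabelled by the bijection from [X] onto its singleton
    classes. *)
Lemma delta_counitr (X : finType) (G : hypergraph X) :
  \sum_(r : eqv X)
    dsum_in K (fun s : eqv X => hypergraph (quo s)) r
      (tensformr (eps_delta K X) (delta K k r (bas K G)))
  = dsum_in K (fun s : eqv X => hypergraph (quo s)) (eqv_eq X)
      (lrelabel K (cls_eq_bij X) (bas K G)).
Proof.
rewrite (bigD1 (eqv_eq X)) //= big1 => [|r rG].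
  rewrite delta_bas eqv_eq_connected tensformr_bas eps_delta_bas.
  by rewrite eqv_eq_extract scale1r addr0 lrelabel_bas hcontract_eq.
rewrite delta_bas; case: ifP => [conn|_]; last by rewrite !linear0.
rewrite tensformr_bas eps_delta_bas; case: eqP => [/eqP Gr|_].
  by case/eqP: rG; apply: eqv_eqP conn Gr.
by rewrite scale0r linear0.
Qed.

Lemma delta_mul (X Y : finType) (G : hypergraph X) (G' : hypergraph Y)
    (rX : eqv X) (rY : eqv Y) :
  tensmap (lrelabel K (sum_iso_bij rX rY)) idfun
    (delta K k (eqv_sum rX rY) (hmul K X Y (tens (bas K G) (bas K G'))))
  = hmul2 K (tens (delta K k rX (bas K G)) (delta K k rY (bas K G'))).
Proof.
rewrite tens_bas hmul_bas !delta_bas eqv_connected_sum hextract_sum.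
rewrite restl_prod restr_prod.
case: (eqv_connected k rX _); last by rewrite andFb tens0l !linear0.
rewrite andTb.
case: (eqv_connected k rY _); last by rewrite tens_bas0 !linear0.
by rewrite tensmap_bas lrelabel_bas hcontract_prod !tens_bas hmul2_bas.
Qed.

Lemma delta_mul0 (X Y : finType) (G : hypergraph X) (G' : hypergraph Y)
    (r : eqv (X + Y)%type) :
  (forall (rX : eqv X) (rY : eqv Y), r <> eqv_sum rX rY) ->
  delta K k r (hmul K X Y (tens (bas K G) (bas K G'))) = 0.
Proof.
move=> rN; rewrite tens_bas hmul_bas delta_bas; case: ifP => // conn.
have [|rX [rY rE]] := @eqv_sum_split _ _ r; last by case: (rN rX rY).
by move=> x y; apply/negP => /(eqv_connected_prod conn).
Qed.

Lemma delta_Delta (X Y : finType) (G : hypergraph (X + Y)%type)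
    (rX : eqv X) (rY : eqv Y) :
  tensmap (Delta K k (quo rX) (quo rY)) idfun
    (tensmap (lrelabel K (sum_iso_bij rX rY)) idfun
      (delta K k (eqv_sum rX rY) (bas K G)))
  = m1_3_24 K
      (tensmap (delta K k rX) (delta K k rY) (Delta K k X Y (bas K G))).
Proof.
rewrite Delta_bas [in RHS]tensmap_bas !delta_bas eqv_connected_sum hextract_sum.
case: (eqv_connected k rX _); last by rewrite andFb tens0l !linear0.
rewrite andTb.
case: (eqv_connected k rY _); last by rewrite tens_bas0 !linear0.
rewrite tensmap_bas lrelabel_bas !tens_bas m1_3_24_bas tensmap_bas Delta_bas.
by rewrite restl_contract restr_contract tens_bas.
Qed.

End Linear.

Theorem theorem1p4 (K : fieldType) (charK : [pchar K] =i pred0)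
    (k : restriction_kind) :
  (* coassociativity *)
  (forall (X : finType) (G : hypergraph X) (r r' : eqv X)
      (le_rr' : eqv_le r r'),
    tensmap (tensmap (lrelabel K (bar_iso_bij le_rr')) idfun) idfun
      (tensmap (delta K k (eqv_bar r r')) idfun (delta K k r' (bas K G)))
    = tensA K (tensmap idfun (delta K k r') (delta K k r (bas K G))))
  /\
  (* counit *)
  ((forall (X : finType) (G : hypergraph X),
     \sum_(r : eqv X) tensforml (eps_delta K (quo r)) (delta K k r (bas K G))
     = bas K G)
   /\
   (forall (X : finType) (G : hypergraph X),
     \sum_(r : eqv X)
       dsum_in K (fun s : eqv X => hypergraph (quo s)) r
         (tensformr (eps_delta K X) (delta K k r (bas K G)))
     = dsum_in K (fun s : eqv X => hypergraph (quo s)) (eqv_eq X)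
         (lrelabel K (cls_eq_bij X) (bas K G))))
  /\
  (* multiplicativity *)
  ((forall (X Y : finType) (G : hypergraph X) (G' : hypergraph Y)
       (rX : eqv X) (rY : eqv Y),
     tensmap (lrelabel K (sum_iso_bij rX rY)) idfun
       (delta K k (eqv_sum rX rY) (hmul K X Y (tens (bas K G) (bas K G'))))
     = hmul2 K
         (tens (delta K k rX (bas K G)) (delta K k rY (bas K G'))))
   /\
   (forall (X Y : finType) (G : hypergraph X) (G' : hypergraph Y)
       (r : eqv (X + Y)%type),
     (forall (rX : eqv X) (rY : eqv Y), r <> eqv_sum rX rY) ->
     delta K k r (hmul K X Y (tens (bas K G) (bas K G'))) = 0))
  /\
  (* compatibility with Delta *)
  (forall (X Y : finType) (G : hypergraph (X + Y)%type)
      (rX : eqv X) (rY : eqv Y),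
    tensmap (Delta K k (quo rX) (quo rY)) idfun
      (tensmap (lrelabel K (sum_iso_bij rX rY)) idfun
        (delta K k (eqv_sum rX rY) (bas K G)))
    = m1_3_24 K
        (tensmap (delta K k rX) (delta K k rY) (Delta K k X Y (bas K G)))).
Proof.
split; first by move=> *; apply: delta_coassoc.
split; first by split=> *; [apply: delta_counitl | apply: delta_counitr].
split; first by split=> *; [apply: delta_mul | apply: delta_mul0].
by move=> *; apply: delta_Delta.
Qed.
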